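(* Let $\mathbf{UN}$ be the class of universally null subsets of $2^\omega$. If there exists a universally null set $X\subseteq 2^\omega$ of cardinality $\mathfrak{c}=2^{\aleph_0}$, then there exists $Y\in\mathbf{UN}\setminus\mathbf{bPN}'\subseteq\mathbf{UN}\setminus\mathbf{PN}'$.
   Context: A set $A\subseteq 2^\omega$ is universally null if it is null with respect to every finite diffused (i.e. vanishing on singletons) Borel measure on $2^\omega$. $2^\omega$ is viewed as a vector space over $\mathbb{Z}_2$; $A+t=\{a+t: a\in A\}$. Perfect set: a nonempty closed subset of $2^\omega$ without isolated points. For a perfect set $P$, let $T_P=\{x\restriction n: x\in P,n\in\omega\}$, and call $w\in T_P$ a branching point if $w^\frown 0,w^\frown 1\in T_P$; $\operatorname{Split}(P)$ is the set of branching points. The canonical order isomorphism $e_P:2^{<\omega}\to\operatorname{Split}(P)$ sends $\emptyset$ to the shortest branching point, and $w^\frown i$ to the shortest branching point extending $e_P(w)^\frown i$. The canonical homeomorphism $h_P:2^\omega\to P$ is $h_P(x)=\bigcup_n e_P(x\restriction n)$. Let $m$ be the standard product (Lebesgue) measure on $2^\omega$. The canonical measure on $P$ is $\mu_P(A)=m(h_P^{-1}[A])$ for $A\subseteq P$ with $h_P^{-1}[A]$ Lebesgue measurable; $A\subseteq P$ is $P$-null if $\mu_P(A)=0$. A branching point is on level $i$ if there are exactly $i$ branching points properly below it (as initial segments); $\operatorname{Split}_i(P)$ is the set of these, $s_i(P)=\min\{|w|:w\in\operatorname{Split}_i(P)\}$, $S_i(P)=\max\{|w|:w\in\operatorname{Split}_i(P)\}$.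 $P$ is balanced if $s_{i+1}(P)>S_i(P)$ for all $i\in\omega$. $\mathbf{PN}'$ (respectively $\mathbf{bPN}'$) is the class of sets $X\subseteq 2^\omega$ such that for every perfect (respectively balanced perfect) set $P\subseteq 2^\omega$ there exists a $G_\delta$ set $G\supseteq X$ such that for every $t\in 2^\omega$ the set $(G+t)\cap P$ is $P$-null. *)

(* Defs.v *)
From HB Require Import structures.
From mathcomp Require Import all_boot all_order all_algebra.
From mathcomp Require Import all_classical all_reals all_analysis.
From mathcomp Require Import borel_hierarchy.

Set Implicit Arguments.
Unset Strict Implicit.
Unset Printing Implicit Defensive.

Import Order.TTheory GRing.Theory Num.Theory.
Import numFieldNormedType.Exports.

Local Open Scope classical_set_scope.
Local Open Scope ring_scope.

(* 2^{<omega} is [seq bool]; the restriction of x to n is [mkseq x n]. *)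
Definition cylinder (w : seq bool) : set cantor_space :=
  [set x | mkseq x (size w) = w].

(* A copy of the Cantor space carrying the semiring of cylinders. *)
Definition cylinder_type : Type := cantor_space.

Definition is_cylinder : set (set cylinder_type) :=
  [set A | A = set0 \/ exists w, A = cylinder w].

Section cylinder_semiring.

Let pad (s : seq bool) : cantor_space := fun n => nth false s n.

Lemma mkseq_pad s n : (n <= size s)%N -> mkseq (pad s) n = take n s.
Proof.
move=> ns; apply: (@eq_from_nth _ false).
  by rewrite size_mkseq size_takel.
by move=> i; rewrite size_mkseq => ilt; rewrite nth_mkseq// nth_take.
Qed.

Lemma take_mkseq (x : cantor_space) m n :
  (m <= n)%N -> take m (mkseq x n) = mkseq x m.
Proof. by move=> mn; rewrite /mkseq -map_take take_iota (minn_idPl mn). Qed.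

Lemma cylinder_pad (w s : seq bool) :
  (size w <= size s)%N -> cylinder w (pad s) = prefix w s :> Prop.
Proof.
by move=> ws; rewrite /cylinder /= mkseq_pad// prefixE; apply/propext; split => /eqP.
Qed.

(* membership in A only depends on the first L coordinates *)
Let decided L (A : set cantor_space) :=
  forall x, A x <-> A (pad (mkseq x L)).

Let decided_cylinder L w : (size w <= L)%N -> decided L (cylinder w).
Proof.
move=> wL x; rewrite cylinder_pad ?size_mkseq// prefixE take_mkseq// /cylinder/=.
by split => /eqP.
Qed.

Let is_cylinder_decided A : is_cylinder A ->
  exists L0, forall L, (L0 <= L)%N -> decided L A.
Proof.
case=> [->|[w ->]]; first by exists 0%N.
by exists (size w) => L; exact: decided_cylinder.
Qed.

Let is_cylinder0 : is_cylinder set0.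
Proof. by left. Qed.

Let is_cylinderI : setI_closed is_cylinder.
Proof.
move=> A B [->|[v ->]]; first by rewrite set0I; left.
move=> [->|[w ->]]; first by rewrite setI0; left.
wlog vw : v w / (size v <= size w)%N.
  move=> h; have [/h//|/ltnW/h] := leqP (size v) (size w).
  by rewrite setIC.
have [pvw|pvw] := eqVneq (take (size v) w) v.
  right; exists w; apply/seteqP; split => [x []//|x xw]; split => //.
  by rewrite /cylinder /= -(take_mkseq x vw) xw.
left; rewrite -subset0 => x [] xv xw; move/eqP: pvw; apply.
by rewrite -xw take_mkseq.
Qed.

Let is_cylinderD : semi_setD_closed is_cylinder.
Proof.
move=> A B /is_cylinder_decided[LA hA] /is_cylinder_decided[LB hB].
pose L := maxn LA LB.
have {}hA : decided L A by apply: hA; exact: leq_maxl.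
have {}hB : decided L B by apply: hB; exact: leq_maxr.
exists [set cylinder (s : seq bool) | s in [set s : L.-tuple bool | (A `\` B) (pad s)]].
split.
- exact/finite_image/finite_finset.
- by move=> _ [s _ <-]; right; exists s.
- apply/seteqP; split => [x [/hA Ax /hB Bx]|x [_ [s [As Bs] <-]]].
    exists (cylinder (mkseq x L)); last by rewrite /cylinder/= size_mkseq.
    by exists (tcast (size_mkseq x L) (in_tuple (mkseq x L))); rewrite /= val_tcast.
  rewrite /cylinder /= size_tuple => xs.
  by split; [apply/hA; rewrite xs|move/hB; rewrite xs].
- move=> _ _ [s _ <-] [t _ <-] [x [xs xt]].
  by move: xs xt; rewrite /cylinder /= !size_tuple => <- <-.
Qed.

Definition cylinder_display : measure_display.
Proof. exact: default_measure_display. Qed.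

HB.instance Definition _ := Pointed.on cylinder_type.
HB.instance Definition _ := @isSemiRingOfSets.Build cylinder_display
  cylinder_type is_cylinder is_cylinder0 is_cylinderI is_cylinderD.

End cylinder_semiring.

Section cylinder_measure.
Context (R : realType).
Local Open Scope ereal_scope.

(* Only the values at set0 and at cylinders matter. *)
Definition cylinder_content (A : set cylinder_type) : \bar R :=
  if A == set0 then 0
  else ((2 ^- size (xget [::] [set w | A = cylinder w]))%R)%:E.

Let pad (s : seq bool) : cantor_space := fun n => nth false s n.

(* the proportion of the words s of length L such that A contains s000... *)
Let unif L (A : set cantor_space) : R :=
  (#|[set s : L.-tuple bool | `[< A (pad s) >]]%SET|%:R / 2 ^+ L)%R.

Let card_prefix (w : seq bool) k :
  #|[set s : (size w + k).-tuple bool | prefix w s]%SET| = (2 ^ k)%N.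
Proof.
pose f (t : k.-tuple bool) := cat_tuple (in_tuple w) t.
have injf : injective f.
  move=> s t /(congr1 val)/= /eqP; rewrite eqseq_cat// eqxx/= => /eqP st.
  exact: val_inj.
transitivity #|[set: k.-tuple bool]%SET|; last by rewrite cardsT card_tuple card_bool.
rewrite -(card_imset _ injf); apply: eq_card => s; rewrite inE.
apply/idP/imsetP => [|[t _ ->]]; last by rewrite /= prefix_prefix.
move/prefixP => [t st].
have tk : size t == k.
  by rewrite -(eqn_add2l (size w)) -size_cat -st size_tuple.
by exists (Tuple tk) => //; apply: val_inj.
Qed.

Let unif_cylinder L w : (size w <= L)%N -> unif L (cylinder w) = (2 ^- size w)%R.
Proof.
move=> wL; rewrite /unif -(subnKC wL); set k := (L - size w)%N.
rewrite (_ : [set s | _]%SET = [set s : (size w + k).-tuple bool | prefix w s]%SET).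
  by rewrite card_prefix natrX exprD invfM mulrCA divff ?mulr1.
apply/setP => s; rewrite !inE cylinder_pad ?size_tuple ?leq_addr//.
by rewrite asboolb.
Qed.

Let unif0 L : unif L set0 = 0%R.
Proof.
rewrite /unif (_ : [set s | _]%SET = finset.set0) ?cards0 ?mul0r//.
by apply/setP => s; rewrite !inE asboolF.
Qed.

Let unifU L A B : A `&` B = set0 -> unif L (A `|` B) = (unif L A + unif L B)%R.
Proof.
move=> AB; rewrite /unif -mulrDl -natrD; congr (_%:R / _)%R.
rewrite -cardsUI (_ : (_ :&: _)%SET = finset.set0).
  rewrite cards0 addn0; apply: eq_card => s; rewrite !inE.
  exact: asbool_or.
apply/setP => s; rewrite !inE -asbool_and; apply/asboolPn.
by move=> ABs; suff: (A `&` B) (pad s) by rewrite AB.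
Qed.

Let cylinder_neq0 w : cylinder w != set0.
Proof.
apply/set0P; exists (pad w).
by rewrite cylinder_pad// prefix_refl.
Qed.

Lemma cylinder_contentE w : cylinder_content (cylinder w) = ((2 ^- size w)%R)%:E.
Proof.
rewrite /cylinder_content (negbTE (cylinder_neq0 w)); congr (_%:E).
case: xgetP => [v _ /= vw|/(_ w)[]//].
rewrite -(@unif_cylinder (maxn (size v) (size w)) v) ?leq_maxl//.
by rewrite -vw unif_cylinder// leq_maxr.
Qed.

Let cylinder_content0 : cylinder_content set0 = 0.
Proof. by rewrite /cylinder_content eqxx. Qed.

Let cylinder_content_ge0 A : 0 <= cylinder_content A.
Proof. by rewrite /cylinder_content; case: ifPn. Qed.

Let cylinder_content_unif A : is_cylinder A ->
  exists L0, forall L, (L0 <= L)%N -> cylinder_content A = (unif L A)%:E.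
Proof.
case=> [->|[w ->]].
  by exists 0%N => L _; rewrite unif0 cylinder_content0.
by exists (size w) => L wL; rewrite cylinder_contentE unif_cylinder.
Qed.

Let open_coord (i : nat) (b : bool) : open [set x : cantor_space | x i = b].
Proof.
rewrite (_ : [set x | _] = proj i @^-1` [set b])//.
by apply: open_comp => [x _|]; [exact: proj_continuous|exact: discrete_open].
Qed.

Lemma open_cylinder w : open (cylinder w).
Proof.
pose H i : set cantor_space := [set x | x i = nth false w i].
rewrite (_ : cylinder w = \big[setI/setT]_(i < size w) H i).
  elim/big_ind : _ => [|A B oA oB|i _]; [exact: openT|exact: openI|exact: open_coord].
rewrite -bigcap_mkord; apply/seteqP; split => [x xw i /= iw|x xw].
  by rewrite /H/= -[in RHS](xw : mkseq x _ = w) nth_mkseq.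
apply: (@eq_from_nth _ false); rewrite size_mkseq// => i iw.
by rewrite nth_mkseq//; exact: xw.
Qed.

Lemma closed_cylinder w : closed (cylinder w).
Proof.
rewrite (_ : cylinder w = ~` \bigcup_(v in [set v | size v = size w /\ v != w]) cylinder v).
  by apply: open_closedC; apply: bigcup_open => v _; exact: open_cylinder.
apply/seteqP; split => [x xw [v [vw /eqP nvw]]|x xw].
  by rewrite /cylinder/= vw => xv; apply: nvw; rewrite -xv.
apply: contrapT => /eqP nxw; apply: xw; exists (mkseq x (size w)).
  by rewrite /= size_mkseq.
by rewrite /cylinder/= size_mkseq.
Qed.

Let cylinder_content_sigma_additive : semi_sigma_additive cylinder_content.
Proof.
move=> F mF tF mUF.
have [N FN] : exists N, forall i, (N <= i)%N -> F i = set0.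
  have : compact (\bigcup_n F n : set cantor_space).
    case: mUF => [->|[w ->]]; first exact: compact0.
    exact: (@subclosed_compact cantor_space _ _ (@closed_cylinder w)
      cantor_space_compact (@subsetT _ _)).
  rewrite compact_cover => /(_ nat setT F).
  have oF i : open (F i : set cantor_space).
    by case: (mF i) => [->|[w ->]]; [exact: open0|exact: open_cylinder].
  case=> [i _||D _ FD]; first exact: oF.
    by [].
  exists (\max_(i <- finmap.enum_fset D) i).+1 => i Di; apply/seteqP; split => // x Fix.
  have [j /= jD Fjx] := FD _ (ex_intro2 _ _ i I Fix).
  have ij : i = j by apply: (tF i j) => //; exists x.
  move: Di; rewrite ij ltnNge => /negP; apply.
  exact: (@leq_bigmax_seq _ (finmap.enum_fset D) xpredT id).
have UFN n : (N <= n)%N -> \bigcup_i F i = \big[setU/set0]_(i < n) F i.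
  move=> Nn; rewrite -bigcup_mkord; apply/seteqP; split => [x [i _ Fix]|x [i _ Fix]]; exists i => //=.
  by rewrite ltnNge; apply/negP => ni; move: Fix; rewrite FN// (leq_trans Nn).
have unifUF L n : unif L (\big[setU/set0]_(i < n) F i) = (\sum_(i < n) unif L (F i))%R.
  elim: n => [|n ih]; first by rewrite !big_ord0 unif0.
  rewrite !big_ord_recr/= unifU ?ih//.
  rewrite -subset0 => x []; rewrite -bigcup_mkord => -[i /= ilt Fix] Fnx.
  by move: ilt; rewrite (tF i n I I) ?ltnn//; exists x.
apply: cvg_near_cst; exists N => // n /= Nn.
have [L0 hL0] := cylinder_content_unif mUF.
have /choice[L hL] := fun i => cylinder_content_unif (mF i).
pose M := maxn L0 (\max_(i < n) L i).
rewrite (hL0 M) ?leq_maxl// (UFN n)// unifUF big_mkord -sumEFin.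
apply: eq_bigr => i _; apply: hL.
by rewrite (leq_trans _ (leq_maxr _ _))//; exact: (leq_bigmax_cond i).
Qed.

HB.instance Definition _ := isMeasure.Build _ _ _ cylinder_content
  cylinder_content0 cylinder_content_ge0 cylinder_content_sigma_additive.

End cylinder_measure.

Section cantor_measure.
Context (R : realType).

(* The product measure m on 2^omega and its (complete) domain: the Caratheodory
   extension of cylinder w |-> 2^-|w|. *)
Definition cantor_measurable : set (set cantor_space) :=
  (mu_ext (@cylinder_content R)).-cara.-measurable.

Definition cantor_measure : set cantor_space -> \bar R :=
  @completed_measure_extension _ _ _ (@cylinder_content R).

Lemma cantor_measurable_cylinder w : cantor_measurable (cylinder w).
Proof. by apply: caratheodory_measurable_mu_ext; right; exists w. Qed.

Lemma cantor_measure_cylinder w :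
  cantor_measure (cylinder w) = ((2 ^- size w)%R)%:E.
Proof.
rewrite /cantor_measure /completed_measure_extension measurable_mu_extE.
  exact: cylinder_contentE.
by right; exists w.
Qed.

End cantor_measure.

Definition cantor_add (x y : cantor_space) : cantor_space :=
  fun n => x n (+) y n.

Definition translate (A : set cantor_space) (t : cantor_space) :
  set cantor_space := [set cantor_add a t | a in A].

Definition perfect (P : set cantor_space) := P !=set0 /\ perfect_set P.

Section canonical_homeomorphism.
Variable P : set cantor_space.

Definition tree : set (seq bool) :=
  [set w | exists x n, P x /\ w = mkseq x n].

Definition Split : set (seq bool) :=
  [set w | tree (rcons w false) /\ tree (rcons w true)].

(* [xget [::]] picks the element of the set; the default [::] is never used
   when P is perfect and v is in its tree. *)
Definition shortest_split (v : seq bool) : seq bool :=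
  xget [::] [set u | [/\ Split u, prefix v u &
    forall u', Split u' -> prefix v u' -> (size u <= size u')%N]].

(* By foldl_rcons, e_P (rcons w i) = shortest_split (rcons (e_P w) i). *)
Definition e_P (w : seq bool) : seq bool :=
  foldl (fun u i => shortest_split (rcons u i)) (shortest_split [::]) w.

(* The union of the finite sequences e_P (x|n), seen as partial functions. *)
Definition h_P (x : cantor_space) : cantor_space :=
  fun k => `[< exists n, onth (e_P (mkseq x n)) k = Some true >].

Definition Split_level (i : nat) : set (seq bool) :=
  [set w | Split w /\
    ([set u | [/\ Split u, prefix u w & u != w]] #= `I_i)%card].

(* For perfect P, Split_level i is finite and nonempty, so that the minimum and
   the maximum exist and the default 0 is not used. *)
Definition s_level (i : nat) : nat :=
  xget 0%N [set n | (size @` Split_level i) n /\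
    forall m, (size @` Split_level i) m -> (n <= m)%N].

Definition S_level (i : nat) : nat :=
  xget 0%N [set n | (size @` Split_level i) n /\
    forall m, (size @` Split_level i) m -> (m <= n)%N].

Definition balanced := forall i, (S_level i < s_level i.+1)%N.

End canonical_homeomorphism.

Section classes.
Variable R : realType.

Definition canonical_measure (P A : set cantor_space) : \bar R :=
  cantor_measure R (h_P P @^-1` A).

Definition P_null (P A : set cantor_space) :=
  [/\ A `<=` P, cantor_measurable R (h_P P @^-1` A) &
      canonical_measure P A = 0%E].

Definition borel_cantor : measurableType _ :=
  g_sigma_algebraType (@open cantor_space).

Definition diffused (mu : set borel_cantor -> \bar R) :=
  forall x : cantor_space, mu [set x] = 0%E.

Definition UN : set (set cantor_space) :=
  [set A | forall mu : {finite_measure set borel_cantor -> \bar R},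
    diffused mu -> mu.-negligible A].

Definition PN' : set (set cantor_space) :=
  [set X | forall P, perfect P ->
    exists G, [/\ Gdelta G, X `<=` G &
      forall t, P_null P (translate G t `&` P)]].

Definition bPN' : set (set cantor_space) :=
  [set X | forall P, perfect P -> balanced P ->
    exists G, [/\ Gdelta G, X `<=` G &
      forall t, P_null P (translate G t `&` P)]].

End classes.

(* Main.v *)
Require Import Defs.
From mathcomp Require Import all_boot all_order all_algebra.
From mathcomp Require Import all_classical all_reals all_analysis.
From mathcomp Require Import borel_hierarchy.
Local Open Scope classical_set_scope.

Set Implicit Arguments.
Unset Strict Implicit.
Unset Printing Implicit Defensive.

Import Order.TTheory GRing.Theory Num.Theory.

(** Write 2^omega as the direct sum of two perfect subgroups: the sequences
    supported on the even coordinates ([evens]) and those supported on the odd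
    coordinates (the range of [on_odds]). The set P = [evens] is a balanced
    perfect set, since all its branching points of level i have length 2i, and
    the cosets P + q, for q supported on the odd coordinates, are the fibres of
    the continuous projection [odd_part].

    Let X be universally null of cardinality continuum. There are only
    continuum many G_delta sets ([code_Gdelta_surj]), so they can be listed as
    G_x with x in X. For each x a point y_x is chosen in the fibre of
    [odd_part] over x. If all the sets (G_x + t) `&` P are P-null, then the one
    for t = [on_odds x] is not the whole of P ([P_null_proper]), so some p in P
    is not in G_x + t; then y_x = p + t is in the fibre over x and not in G_x.
    The set Y of all the y_x is therefore not covered by any G_delta set
    witnessing the bPN' condition for P: such a set would be G_x for some x,
    and it would miss y_x.

    On the other hand Y is mapped injectively into X by a continuous function,
    which suffices for Y to be universally null ([UN_preimage]). The image under
    [odd_part] of a diffused finite measure need not be diffused, but it has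
    only countably many atoms ([countable_atoms]). Outside these atoms the image
    measure is diffused, so X is negligible for it; and only countably many
    points of Y lie over the atoms. *)

(** * Basic open sets of the Cantor space and codes of G_delta sets *)

Lemma in_cylinder_mkseq (x y : cantor_space) n :
  cylinder (mkseq x n) y <-> forall i, (i < n)%N -> y i = x i.
Proof.
rewrite /cylinder /= size_mkseq; split => [yx i ilt|yx].
  by rewrite -(nth_mkseq false y ilt) yx nth_mkseq.
apply: (@eq_from_nth _ false); rewrite !size_mkseq// => i ilt.
by rewrite !nth_mkseq// yx.
Qed.

(** If no cylinder around x were contained in U, then points outside U picked in
    the successive cylinders would converge to x coordinatewise. *)
Lemma nbhs_cylinder (x : cantor_space) (U : set cantor_space) :
  nbhs x U <-> exists n, cylinder (mkseq x n) `<=` U.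
Proof.
split=> [xU|[n nU]]; last first.
  apply: (filterS nU); apply: open_nbhs_nbhs; split; first exact: open_cylinder.
  exact/in_cylinder_mkseq.
apply: contrapT => /forallNP nU.
have /choice[y yP] n : exists y, cylinder (mkseq x n) y /\ ~ U y.
  by have /existsNP[y /not_implyP[]] := nU n; exists y.
have : y @ \oo --> x.
  apply/cvg_sup => i.
  have pT : range (fun z : nat -> bool => z i) = [set: bool].
    by apply/seteqP; split=> // b _; exists (fun=> b).
  apply/(cvg_image _ _ pT) => V Vxi.
  exists ((fun z : nat -> bool => z i) @^-1` V); last by rewrite image_preimage.
  exists i.+1 => // n /= ilt.
  rewrite (proj1 (in_cylinder_mkseq _ _ _) (yP n).1)//.
  exact: nbhs_singleton.
move=> /(_ _ xU) [n _ /(_ n (leqnn n))].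
by apply: (yP n).2.
Qed.

Lemma open_cylinders (A : set cantor_space) :
  open A <-> forall x, A x -> exists n, cylinder (mkseq x n) `<=` A.
Proof.
rewrite openE; split=> h x /h; first by move/nbhs_cylinder.
by move=> ?; apply/nbhs_cylinder.
Qed.

(** A G_delta set is given by countably many open sets, and an open set by the
    words whose cylinders it contains; as pairs of an index and a word are
    countable, this information fits in one binary sequence. *)
Definition code_Gdelta (c : nat -> bool) : set cantor_space :=
  \bigcap_n
    \bigcup_(w in [set w | c (@pickle (nat * seq bool)%type (n, w))])
      cylinder w.

Lemma code_Gdelta_surj G : Gdelta G -> exists c, code_Gdelta c = G.
Proof.
case=> F oF ->.
pose c k := if @unpickle (nat * seq bool)%type k is Some (n, w)
  then `[< cylinder w `<=` F n >] else false.
exists c; apply: eq_bigcapr => n _; apply/seteqP; split => [x [w /=]|x].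
  by rewrite /c pickleK => /asboolP; apply.
move=> Fx; have /(open_cylinders _).1/(_ x Fx)[k kF] := oF n.
exists (mkseq x k); first by rewrite /= /c pickleK; apply/asboolP.
exact/in_cylinder_mkseq.
Qed.

(** * The balanced perfect set of sequences supported on even coordinates *)

Definition evens : set cantor_space := [set x | forall n, odd n -> x n = false].

Definition odd_part (x : cantor_space) : cantor_space := fun n => x n.*2.+1.

Definition on_odds (x : cantor_space) : cantor_space :=
  fun n => odd n && x n./2.

Lemma odd_part_continuous : continuous odd_part.
Proof.
apply/continuousP => A /open_cylinders oA; apply/open_cylinders => x /oA[n nA].
exists n.*2 => y /in_cylinder_mkseq yx.
apply: nA; apply/in_cylinder_mkseq => i ilt.
by apply: yx; rewrite ltn_Sdouble.
Qed.

Lemma odd_part_add p x : evens p -> odd_part (cantor_add p (on_odds x)) = x.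
Proof.
move=> pP; apply/funext => n.
rewrite /odd_part/cantor_add/on_odds pP/= ?odd_double//.
by rewrite uphalf_double.
Qed.

Lemma cantor_addK x y : cantor_add (cantor_add x y) y = x.
Proof. by apply/funext => n; rewrite /cantor_add addbK. Qed.

(** Flipping a far even coordinate of a point gives another point of the set
    nearby, so no point is isolated. *)
Lemma perfect_evens : perfect evens.
Proof.
have cP : closed evens.
  move=> x clx n on; apply: contrapT => xn.
  have /clx[y [yP /in_cylinder_mkseq yx]] : nbhs x (cylinder (mkseq x n.+1)).
    by apply/nbhs_cylinder; exists n.+1.
  by apply: xn; rewrite -yx// yP.
split; first by exists (fun=> false).
split=> //; apply/seteqP; split => [x xP|x xP U /nbhs_cylinder[n nU]].
  by apply: cP => U /xP[y [_ Py Uy]]; exists y.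
pose y : cantor_space := fun i => x i (+) (i == n.*2).
exists y; split.
- apply/eqP => yx; have := congr1 (fun f : nat -> bool => f n.*2) yx.
  by rewrite /y eqxx addbT => /esym; case: (x _).
- move=> i oi; rewrite /y xP//.
  by have [ii|//] := eqVneq; rewrite ii odd_double in oi.
- apply: nU; apply/in_cylinder_mkseq => i ilt; rewrite /y.
  rewrite (_ : (i == n.*2) = false) ?addbF//; apply/eqP => ii.
  by move: ilt; rewrite ii -addnn -[ltnRHS]addn0 ltn_add2l ltn0.
Qed.

Lemma tree_evens w :
  tree evens w <-> forall i, odd i -> nth false w i = false.
Proof.
split=> [[x [n [xP ->]] i oi]|wP]; last first.
  by exists (nth false w), (size w); rewrite mkseq_nth.
have [ilt|nle] := ltnP i n; first by rewrite nth_mkseq// xP.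
by rewrite nth_default// size_mkseq.
Qed.

Lemma Split_evens w : Defs.Split evens w <-> tree evens w /\ ~~ odd (size w).
Proof.
split=> [[/tree_evens t0 /tree_evens t1]|[/tree_evens wP ew]].
  split; last by apply/negP => /t1; rewrite nth_rcons ltnn eqxx.
  apply/tree_evens => i oi; have := t0 _ oi; rewrite nth_rcons.
  by case: ltngtP => // [slt _|-> _]; rewrite nth_default// ltnW.
have h b : tree evens (rcons w b).
  apply/tree_evens => i oi; rewrite nth_rcons; case: ltngtP => // [_|ii].
    exact: wP.
  by rewrite -ii oi in ew.
by split.
Qed.

(** The branching points below w are its proper initial segments of even
    length. *)
Lemma Split_evens_prefixes w : Defs.Split evens w ->
  ([set u | [/\ Defs.Split evens u, prefix u w & u != w]]
     #= `I_(size w)./2)%card.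
Proof.
move=> /Split_evens[/tree_evens wP ew].
have lt_w j : (j < (size w)./2)%N = (j.*2 < size w)%N.
  by rewrite -[in RHS](even_halfK ew) ltn_double.
have -> : [set u | [/\ Defs.Split evens u, prefix u w & u != w]] =
    (fun j => take j.*2 w) @` `I_(size w)./2.
  apply/seteqP; split => [u [/Split_evens[_ eu] /prefixP[s ws] uw]|_ [j jw <-]].
    exists (size u)./2; rewrite /= ?lt_w even_halfK//; last first.
      by rewrite ws take_size_cat.
    by move: uw; rewrite ws size_cat; case: (s) => [|b t _];
      rewrite ?cats0 ?eqxx// addnS ltnS leq_addr.
  move: jw; rewrite /= lt_w => jw; split; last 2 first.
  - exact: prefix_take.
  - apply/eqP => /(congr1 size); rewrite size_takel ?(ltnW jw)// => jw'.
    by rewrite jw' ltnn in jw.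
  apply/Split_evens; rewrite size_takel ?(ltnW jw)// odd_double; split=> //.
  apply/tree_evens => i oi; have [ij|ji] := ltnP i j.*2.
    by rewrite nth_take// wP.
  by rewrite nth_default// size_takel// ltnW.
apply: inj_card_eq => i j /set_mem/= iw /set_mem/= jw /(congr1 size).
by rewrite !size_takel; [exact: double_inj|rewrite ltnW// -lt_w ..].
Qed.

Lemma size_Split_level_evens i : size @` Split_level evens i = [set i.*2].
Proof.
apply/seteqP; split => [_ [w [wS wi] <-]|_ ->].
  have := Split_evens_prefixes wS; rewrite card_eq_sym => /card_eq_trans/(_ wi).
  move=> /card_eq_II <-; rewrite /= even_halfK//.
  by have /Split_evens[] := wS.
have S : Defs.Split evens (nseq i.*2 false).
  apply/Split_evens; rewrite size_nseq odd_double; split=> //.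
  by apply/tree_evens => k _; rewrite nth_nseq if_same.
exists (nseq i.*2 false); rewrite ?size_nseq//; split=> //.
by have := Split_evens_prefixes S; rewrite size_nseq doubleK.
Qed.

Lemma balanced_evens : balanced evens.
Proof.
move=> i; rewrite /s_level /S_level !size_Split_level_evens.
case: xgetP => [n _ [-> _]|/(_ i.*2)[]]; last by split=> // m ->.
case: xgetP => [m _ [-> _]|/(_ i.+1.*2)[]]; last by split=> // k ->.
by rewrite ltn_double.
Qed.

(** * The canonical map of a perfect set *)

(** The empty word is the default value of [shortest_split]. Allowing for it
    makes the claim independent of the existence of branching points. *)
Lemma tree_e_P P w : e_P P w = [::] \/ tree P (e_P P w).
Proof.
have h v : shortest_split P v = [::] \/ tree P (shortest_split P v).
  rewrite /shortest_split; case: xgetP => [u _ [[uS _] _ _]|_]; [right|by left].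
  case: uS => x [n [Px un]]; exists x, (size u); split=> //.
  rewrite -(@take_mkseq x (size u) n) -?un -?cats1 ?take_size_cat//.
  by rewrite -(size_mkseq x n) -un size_rcons.
by rewrite /e_P; case/lastP: w => [|w b]; rewrite ?foldl_rcons; exact: h.
Qed.

(** A finite word of the tree of [evens], or the empty word, never has the value
    true at an odd position; so neither does a union of such words. *)
Lemma h_P_evens x : evens (h_P evens x).
Proof.
move=> n on; apply/asboolPn => -[k].
have [->|/tree_evens wP] := tree_e_P evens (mkseq x k); first by rewrite onth0n.
by move/(onth_nth false); rewrite wP.
Qed.

(** The canonical measure has total mass 1, so a P-null set misses a point
    of P. *)
Lemma P_null_proper (R : realType) P A : (forall x, P (h_P P x)) ->
  P_null R P A -> exists2 p, P p & ~ A p.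
Proof.
move=> hP [AP _ A0]; apply: contrapT => /forall2NP PA.
have : h_P P @^-1` A = cylinder [::].
  apply/seteqP; split => // x _.
  by have [/(_ (hP x))|/contrapT] := PA (h_P P x).
move: A0; rewrite /canonical_measure => /[swap] ->.
rewrite cantor_measure_cylinder/=.
by rewrite expr0 invr1 => /eqP; rewrite eqe oner_eq0.
Qed.

(** * Universally null sets and continuous preimages *)

(** For each n, only finitely many points have mass more than 1/(n+1), as
    otherwise enough of them would together exceed the total mass. *)
Lemma countable_atoms d (T : measurableType d) (R : realType)
    (mu : {measure set T -> \bar R}%R) :
  (forall a : T, measurable [set a]) -> fin_num_fun mu ->
  countable [set a | mu [set a] != 0%E].
Proof.
move=> m1 fmu.
rewrite (_ : [set a | _] =
    \bigcup_n [set a | (n.+1%:R^-1)%R < fine (mu [set a])]%R); last first.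
  apply/seteqP; split => [a /= a0|a [n _ /= na]].
    have : (0 < fine (mu [set a]))%R.
      by rewrite fine_gt0// lt0e a0 measure_ge0 ltey_eq fmu.
    by move=> /ltr_add_invr[k]; rewrite add0r => ka; exists k.
  by apply/eqP => a0; move: na; rewrite a0/= ltNge invr_ge0 ler0n.
apply: bigcup_countable => // n _; apply: finite_set_countable.
apply: contrapT => /infiniteP/pcard_leP/injfunPex[/= q q_fun q_inj].
(* N points of mass more than 1/(n+1) have together at least the mass
   truncn (mu setT) + 1. *)
pose N := (n.+1 * (Num.truncn (fine (mu setT))).+1)%N.
have : (\sum_(k < N) mu [set q k] <= mu setT)%E.
  have tq : trivIset setT (fun k => [set q k]).
    apply/trivIsetP => i j _ _ ij; apply/seteqP; split=> // x [/= ->].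
    by move/q_inj => qij; rewrite qij ?eqxx ?in_setT in ij.
  rewrite -(measure_bigsetU mu (F := fun k => [set q k]) (fun k => m1 (q k)))//.
  by apply: le_measure => //; rewrite inE//; exact: bigsetU_measurable.
apply/negP; rewrite -ltNge -(fineK (fmu _ (@measurableT _ T))).
apply: (@lt_le_trans _ _ (\sum_(k < N) (n.+1%:R^-1)%:E)%E).
  rewrite sumEFin lte_fin sumr_const card_ord -[ltRHS]mulr_natr /N natrM.
  rewrite mulrA mulVf// mul1r.
  by have /andP[] := truncn_itv (fine_ge0 (measure_ge0 mu setT)).
by apply: lee_sum => k _; rewrite -[leRHS]fineK ?fmu// lee_fin ltW// q_fun.
Qed.

Lemma measurable_continuous_borel (f : cantor_space -> cantor_space) :
  continuous f ->
  measurable_fun [set: borel_cantor] (f : borel_cantor -> borel_cantor).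
Proof.
move=> /continuousP cf.
apply: (@measurability _ _ borel_cantor borel_cantor setT f
  (@open cantor_space)) => // _ [A oA <-].
by rewrite setTI; apply: sub_sigma_algebra; exact: cf.
Qed.

Lemma measurable_singleton (a : borel_cantor) : measurable [set a].
Proof.
rewrite -[X in measurable X]setCK; apply: measurableC; apply: sub_sigma_algebra.
apply: closed_openC; apply: accessible_closed_set1; apply: hausdorff_accessible.
exact: cantor_space_hausdorff.
Qed.

Lemma negligible_countable (R : realType)
    (mu : {finite_measure set borel_cantor -> \bar R}%R)
    (A : set borel_cantor) :
  diffused mu -> countable A -> mu.-negligible A.
Proof.
move=> dmu /countable_injP[f injf].
apply: (@negligibleS _ _ _ _ (\bigcup_n (A `&` f @^-1` [set n]))).
  by move=> a Aa; exists (f a).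
apply: negligible_bigcup => n.
have [->|/set0P[a [Aa fa]]] := eqVneq (A `&` f @^-1` [set n]) set0.
  exact: negligible_set0.
apply: (@negligibleS _ _ _ _ [set a]).
  by move=> b [Ab fb]; apply: injf; rewrite ?inE// fa fb.
by apply/negligibleP; [exact: measurable_singleton|exact: dmu].
Qed.

(** The image measure of mu under f, restricted to the complement of its set D
    of atoms, is diffused and thus makes X negligible. The part of Y over D is
    countable by injectivity, and so negligible because mu is diffused. *)
Lemma UN_preimage (R : realType) (X Y : set cantor_space)
    (f : cantor_space -> cantor_space) :
  continuous f -> set_inj Y f -> f @` Y `<=` X -> UN R X -> UN R Y.
Proof.
move=> cf injf fYX uX mu dmu.
have mf := measurable_continuous_borel cf.
have fin_pf : fin_num_fun (pushforward mu (f : borel_cantor -> borel_cantor)).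
  move=> A mA; apply: fin_num_measure.
  by rewrite -[X in measurable X]setTI; exact: mf.
(* The measure structure on a pushforward takes the measurability of f as an
   argument, which unification leaves open. *)
pose pf : {measure set borel_cantor -> \bar R}%R :=
  pushforward mu (f : borel_cantor -> borel_cantor).
pose nu := pf mf.
pose D : set borel_cantor := [set a | nu [set a] != 0%E].
have cD : countable D by apply: countable_atoms measurable_singleton _.
have mD : measurable (~` D).
  apply: measurableC.
  by apply: countable_measurable => //; exact: measurable_singleton.
have fD : (nu (~` D) < +oo)%E by rewrite ltey_eq (fin_pf _ mD).
pose nuD : {finite_measure set borel_cantor -> \bar R}%R := mfrestr mD fD.
have dnuD : diffused nuD.
  move=> a; rewrite /nuD /= /mfrestr /mrestr; have [Da|nDa] := pselect (D a).
    rewrite (_ : _ `&` _ = set0) ?measure0//.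
    by apply/seteqP; split=> // b [/= ->].
  rewrite (_ : _ `&` _ = [set a]).
    by apply: contrapT => /eqP.
  by apply/seteqP; split=> [b []//|b /= ->]; split.
have [B [mB B0 XB]] := uX nuD dnuD.
apply: (@negligibleS _ borel_cantor R mu
  ((f @^-1` (B `&` ~` D)) `|` (Y `&` f @^-1` D))).
  move=> y Yy; have [Dfy|nDfy] := pselect (D (f y)); first by right.
  by left; split=> //; apply: XB; apply: fYX; exists y.
apply: negligibleU.
  apply/negligibleP; last exact: B0.
  rewrite -[X in measurable X]setTI.
  exact: (mf measurableT _ (measurableI _ _ mB mD)).
apply: negligible_countable => //.
move/countable_injP: cD => [g injg]; apply/countable_injP; exists (g \o f).
move=> x y /set_mem[Yx Dx] /set_mem[Yy Dy] /= gxy; apply: injf; rewrite ?inE//.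
by apply: injg; rewrite ?inE.
Qed.

Theorem theorem3p7 (R : realType) :
  (exists X : set cantor_space,
     UN R X /\ (X #= [set: nat -> bool])%card) ->
  (exists Y : set cantor_space, (UN R `\` bPN' R) Y) /\
  UN R `\` bPN' R `<=` UN R `\` PN' R.
Proof.
move=> [X [uX cX]]; split; last first.
  by move=> Y [uY nY]; split=> // PNY; apply: nY => P pP _; exact: PNY.
(* As c is onto the codes, each G_delta set is G x for some x in X. *)
have /card_set_bijP[c [_ _ surjc]] : (X #= [set: cantor_space])%card := cX.
pose G x := code_Gdelta (c x).
pose good x := forall t, P_null R evens (translate (G x) t `&` evens).
have /choice[y yP] x : exists y, odd_part y = x /\ (good x -> ~ G x y).
  have [gx|ngx] := pselect (good x); last first.
    by exists (cantor_add (fun=> false) (on_odds x)); rewrite odd_part_add.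
  have [p Pp nGp] := P_null_proper h_P_evens (gx (on_odds x)).
  exists (cantor_add p (on_odds x)); rewrite odd_part_add//; split=> // _ Gp.
  apply: nGp; split=> //; exists (cantor_add p (on_odds x)) => //.
  exact: cantor_addK.
exists (y @` X); split.
  apply: (@UN_preimage _ X _ odd_part) => //; first exact: odd_part_continuous.
    by move=> _ _ /set_mem[a _ <-] /set_mem[b _ <-]; rewrite !(yP _).1 => ->.
  by move=> _ [_ [a Xa <-] <-]; rewrite (yP a).1.
move=> /(_ evens perfect_evens balanced_evens).
move=> [H [/code_Gdelta_surj[k <-] YH Hnull]].
have [x Xx cx] := surjc k Logic.I.
apply: (yP x).2; first by rewrite /good /G cx.
by rewrite /G cx; apply: YH; exists x.
Qed.
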